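(* Let $k,m\in\mathbb{N}$ and $x\in\mathbb{R}^{m+1}$. Then the polynomials $$\mathcal{P}_k^m(x)=\sum_{s=0}^kT_s^k(m)\,x^{k-s}\bar{x}^s,\qquad T_s^k(m)=\binom ks\frac{\left(\frac{m-1}2\right)_{k-s}\left(\frac{m-1}2\right)_s}{(m-1)_k},$$ are axially harmonic.
   Context: $\mathbb{R}_m$ is the real associative Clifford algebra generated by $e_1,\dots,e_m$ with $e_je_\ell+e_\ell e_j=-2\delta_{j\ell}$; points of $\mathbb{R}^{m+1}$ are paravectors $x=x_0+\underline{x}$, $\underline{x}=\sum_{j=1}^mx_je_j$, and $\bar{x}=x_0-\underline{x}$. $(a)_s=\Gamma(a+s)/\Gamma(a)$ is the Pochhammer symbol. A real-analytic $\mathbb{R}_m$-valued function $f$ is axially harmonic if it has the form $f(x_0+\underline{x})=\alpha(x_0,|\underline{x}|)+\frac{\underline{x}}{|\underline{x}|}\beta(x_0,|\underline{x}|)$ with $\alpha,\beta$ real-analytic $\mathbb{R}_m$-valued, $\alpha$ even and $\beta$ odd in the second variable, and $\sum_{j=0}^m\partial_{x_j}^2f=0$.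
   Formalization: For m = 1 the coefficients T_s^k(1) are 0/0 as written (k ≥ 1); they are read as the limit of the same formula as the parameter m, taken real, tends to 1 from the right. Natural m starts at 1. *)

(* Defs.v *)
From HB Require Import structures.
From mathcomp Require Import all_boot all_order all_algebra.
From mathcomp Require Import all_classical all_reals all_analysis.
From mathcomp.analysis.showcase Require Import summability.

Set Implicit Arguments.
Unset Strict Implicit.
Unset Printing Implicit Defensive.

Import Order.TTheory GRing.Theory Num.Theory.
Import numFieldNormedType.Exports.

Local Open Scope classical_set_scope.
Local Open Scope ring_scope.

(* The Clifford algebra R_m, as the free module on the basis elements e_A,
   A a subset of {0, ..., m-1} (generators are numbered from 0), where e_A is
   the product of the e_i, i in A, in increasing order.  The product is
   e_A e_B = (-1)^(number of (i, j) in A x B with j <= i) e_(A delta B):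
   pairs with j < i count transpositions, pairs with j = i count e_i^2 = -1. *)
Definition clifford (R : comNzRingType) (m : nat) := {ffun {set 'I_m} -> R}.

Section Clifford.
Variables (R : comNzRingType) (m : nat).
Implicit Types (A B C D : {set 'I_m}).
Local Notation cl := (clifford R m).

HB.instance Definition _ := GRing.Zmodule.copy cl {ffun {set 'I_m} -> R}.

Definition symdiff A B : {set 'I_m} := [set i | (i \in A) (+) (i \in B)].

Definition clifford_sign A B : R :=
  (-1) ^+ (\sum_(i in A) \sum_(j in B) (j <= i)%N).

Definition clifford_coord (x : cl) A : R := x A.

Definition clifford_basis A : cl := [ffun B => (B == A)%:R].

Definition clifford_gen (i : 'I_m) : cl := clifford_basis [set i]%SET.

Definition clifford_scale (a : R) (x : cl) : cl := [ffun C => a * x C].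

Definition clifford_mul (x y : cl) : cl :=
  [ffun C => \sum_A clifford_sign A (symdiff A C) * x A * y (symdiff A C)].

Let symdiffA : associative symdiff.
Proof. by move=> A B C; apply/setP=> i; rewrite !inE addbA. Qed.

Let symdiffC : commutative symdiff.
Proof. by move=> A B; apply/setP=> i; rewrite !inE addbC. Qed.

Let symdiffK A : involutive (symdiff A).
Proof. by move=> B; apply/setP=> i; rewrite !inE addbA addbb. Qed.

Let symdiff0 A : symdiff A finset.set0 = A.
Proof. by apply/setP=> i; rewrite !inE addbF. Qed.

Let symdiff0l A : symdiff finset.set0 A = A.
Proof. by rewrite symdiffC symdiff0. Qed.

Let symdiffAA A : symdiff A A = finset.set0.
Proof. by apply/setP=> i; rewrite !inE addbb. Qed.

Let sign_sum (f : 'I_m -> nat) A B :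
  (-1) ^+ (\sum_(i in symdiff A B) f i) =
  (-1) ^+ (\sum_(i in A) f i) * (-1) ^+ (\sum_(i in B) f i) :> R.
Proof.
rewrite -exprD !(big_mkcond (fun i => i \in _)) -big_split /=.
elim/big_rec2: _ => // i a b _ e; rewrite !exprD -{}e inE.
case: (i \in A); case: (i \in B); rewrite /= ?addn0 ?add0n // expr0
  ?mulr1 ?mul1r //.
by rewrite -exprD addnn -mul2n exprM sqrrN !expr1n mul1r.
Qed.

Let clifford_signDl A B C :
  clifford_sign (symdiff A B) C = clifford_sign A C * clifford_sign B C.
Proof. exact: sign_sum. Qed.

Let clifford_signDr A B C :
  clifford_sign A (symdiff B C) = clifford_sign A B * clifford_sign A C.
Proof.
have E D : clifford_sign A D = (-1) ^+ (\sum_(j in D) \sum_(i in A) (j <= i)%N).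
  by rewrite /clifford_sign exchange_big.
by rewrite !E sign_sum.
Qed.

Let clifford_sign0l A : clifford_sign finset.set0 A = 1.
Proof. by rewrite /clifford_sign big_set0. Qed.

Let clifford_sign0r A : clifford_sign A finset.set0 = 1.
Proof. by rewrite /clifford_sign big1 // => i _; rewrite big_set0. Qed.

Let clifford_mulA : associative clifford_mul.
Proof.
move=> x y z; apply/ffunP=> D; rewrite !ffunE.
transitivity (\sum_A \sum_B
    clifford_sign A B * clifford_sign (symdiff A B) (symdiff (symdiff A B) D) *
    x A * y B * z (symdiff (symdiff A B) D)).
  apply: eq_bigr => A _; rewrite ffunE mulr_sumr; apply: eq_bigr => B _.
  have -> : symdiff B (symdiff A D) = symdiff (symdiff A B) D.
    by rewrite symdiffA (symdiffC B).
  set C := symdiff (symdiff A B) D.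
  have -> : symdiff A D = symdiff B C.
    by rewrite /C (symdiffC A B) -symdiffA symdiffK.
  rewrite clifford_signDr clifford_signDl !mulrA; congr (_ * z _).
  by rewrite -!mulrA; do 2 congr (_ * _); exact: mulrCA.
under [RHS]eq_bigr => E _ do rewrite ffunE mulr_sumr mulr_suml.
rewrite [RHS]exchange_big; apply: eq_bigr => A _ /=.
rewrite [RHS](reindex_inj (can_inj (symdiffK A))).
apply: eq_bigr => B _; rewrite symdiffK !mulrA; congr (_ * _ * _ * _).
by rewrite mulrC.
Qed.

Let clifford_one : cl := clifford_basis finset.set0.

Let clifford_mul1l : left_id clifford_one clifford_mul.
Proof.
move=> x; apply/ffunP=> C; rewrite ffunE (bigD1 finset.set0) //= big1 => [|A nA].
  by rewrite ffunE eqxx addr0 symdiff0l clifford_sign0l !mul1r.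
by rewrite ffunE (negPf nA) mulr0 mul0r.
Qed.

Let clifford_mul1r : right_id clifford_one clifford_mul.
Proof.
move=> x; apply/ffunP=> C; rewrite ffunE (bigD1 C) //= big1 => [|A nA].
  by rewrite ffunE symdiffAA eqxx addr0 clifford_sign0r mul1r mulr1.
rewrite ffunE; case: eqP => [E|]; last by rewrite mulr0.
by case/eqP: nA; rewrite -[C](symdiffK A) E symdiff0.
Qed.

Let clifford_mulDl : left_distributive clifford_mul +%R.
Proof.
move=> x y z; apply/ffunP=> C; rewrite !ffunE -big_split; apply: eq_bigr=> A _.
by rewrite ffunE mulrDr mulrDl.
Qed.

Let clifford_mulDr : right_distributive clifford_mul +%R.
Proof.
move=> x y z; apply/ffunP=> C; rewrite !ffunE -big_split; apply: eq_bigr=> A _.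
by rewrite ffunE mulrDr.
Qed.

Let clifford_one_neq0 : clifford_one != 0.
Proof.
apply/eqP=> /ffunP /(_ finset.set0); rewrite !ffunE eqxx.
by move/eqP; rewrite oner_eq0.
Qed.

HB.instance Definition _ := GRing.Zmodule_isNzRing.Build cl
  clifford_mulA clifford_mul1l clifford_mul1r clifford_mulDl clifford_mulDr
  clifford_one_neq0.

Let clifford_scaleA a b (x : cl) :
  clifford_scale a (clifford_scale b x) = clifford_scale (a * b) x.
Proof. by apply/ffunP=> C; rewrite !ffunE mulrA. Qed.

Let clifford_scale1 : left_id 1 clifford_scale.
Proof. by move=> x; apply/ffunP=> C; rewrite !ffunE mul1r. Qed.

Let clifford_scaleDr : right_distributive clifford_scale +%R.
Proof. by move=> a x y; apply/ffunP=> C; rewrite !ffunE mulrDr. Qed.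

Let clifford_scaleDl (x : cl) : {morph clifford_scale^~ x : a b / a + b}.
Proof. by move=> a b; apply/ffunP=> C; rewrite !ffunE mulrDl. Qed.

HB.instance Definition _ := GRing.Zmodule_isLmodule.Build R cl
  clifford_scaleA clifford_scale1 clifford_scaleDr clifford_scaleDl.

Let clifford_scaleAl (a : R) (x y : cl) : a *: (x * y) = (a *: x) * y.
Proof.
apply/ffunP=> C; rewrite !ffunE mulr_sumr; apply: eq_bigr=> A _.
by rewrite ffunE !mulrA [_ * a]mulrC.
Qed.

HB.instance Definition _ := GRing.Lmodule_isLalgebra.Build R cl clifford_scaleAl.

Let clifford_scaleAr (a : R) (x y : cl) : a *: (x * y) = x * (a *: y).
Proof.
apply/ffunP=> C; rewrite !ffunE mulr_sumr; apply: eq_bigr=> A _.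
by rewrite ffunE mulrCA.
Qed.

HB.instance Definition _ := GRing.Lalgebra_isAlgebra.Build R cl clifford_scaleAr.

Lemma clifford_basisM A B :
  clifford_basis A * clifford_basis B =
  clifford_sign A B *: clifford_basis (symdiff A B).
Proof.
apply/ffunP=> C; rewrite !ffunE (bigD1 A) //= big1 => [|D nD].
  rewrite !ffunE eqxx addr0 mulr1.
  have -> : (symdiff A C == B) = (C == symdiff A B).
    by rewrite -(inj_eq (can_inj (symdiffK A))) symdiffK.
  by case: eqP => [->|]; rewrite ?mulr0 // symdiffK.
by rewrite !ffunE (negPf nD) mulr0 mul0r.
Qed.

Lemma clifford_genM (i j : 'I_m) :
  clifford_gen i * clifford_gen j + clifford_gen j * clifford_gen i =
  (- 2 * (i == j)%:R)%:A.
Proof.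
rewrite !clifford_basisM symdiffC -scalerDl /clifford_sign !big_set1.
have [->|nij] := eqVneq i j.
  by rewrite symdiffAA leqnn mulr1 expr1 -opprD.
rewrite mulr0 scale0r; case: ltngtP nij => [||/val_inj->]; rewrite ?eqxx // => _ _.
- by rewrite expr0 expr1 addNr scale0r.
- by rewrite expr0 expr1 subrr scale0r.
Qed.

Lemma clifford_basis_prod A :
  clifford_basis A = \prod_(i <- enum A) clifford_gen i.
Proof.
have P s : pairwise (fun i j : 'I_m => (i < j)%N) s ->
  clifford_basis [set i in s] = \prod_(i <- s) clifford_gen i.
  elim: s => [_|i s IHs /= /andP[lis ps]].
    by rewrite big_nil; congr clifford_basis; apply/setP=> i; rewrite !inE.
  rewrite big_cons -IHs // clifford_basisM /clifford_sign big_set1 big1.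
    rewrite expr0 scale1r; congr clifford_basis; apply/setP=> j; rewrite !inE.
    case: eqP => [->|//]; case: (boolP (i \in s)) => // /(allP lis).
    by rewrite ltnn.
  by move=> j; rewrite inE => /(allP lis)/= ij; rewrite leqNgt ij.
rewrite -P; first by congr clifford_basis; apply/setP=> i; rewrite inE mem_enum.
have tr : transitive (fun i j : 'I_m => (i < j)%N).
  by move=> i j k; apply: ltn_trans.
rewrite -sorted_pairwise // /enum_mem; apply: sorted_filter => //.
have := iota_ltn_sorted 0 m; rewrite -val_enum_ord sorted_map.
by rewrite enumT.
Qed.

Lemma clifford_basis_decomp (x : cl) :
  x = \sum_A clifford_coord x A *: clifford_basis A.
Proof.
apply/ffunP=> C; rewrite sum_ffunE (bigD1 C) //= big1 => [|A nA].
  by rewrite !ffunE eqxx mulr1 addr0.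
by rewrite !ffunE eq_sym (negPf nA) mulr0.
Qed.

End Clifford.

Section Paravectors.
Variables (R : rcfType) (m : nat).
Implicit Types x : 'rV[R]_m.+1.

Definition scalar_part x : R := x 0 0.

Definition vector_part x : clifford R m :=
  \sum_(j < m) x 0 (lift ord0 j) *: clifford_gen R j.

Definition paravector x : clifford R m := (scalar_part x)%:A + vector_part x.

Definition paravector_conj x : clifford R m :=
  (scalar_part x)%:A - vector_part x.

(* The norm of the library on row vectors is the sup norm, not this one. *)
Definition vector_part_norm x : R :=
  Num.sqrt (\sum_(j < m) x 0 (lift ord0 j) ^+ 2).

End Paravectors.

Section AxiallyHarmonic.
Variable R : realType.

Definition power_term n (c : {ffun 'I_n -> nat} -> R) (a x : 'rV[R]_n)
    (k : {ffun 'I_n -> nat}) : R :=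
  c k * \prod_(i < n) (x 0 i - a 0 i) ^+ k i.

(* Near every point, f is the sum of a power series in n variables.  The sum
   over multi-indices is the limit along finite sets of multi-indices, i.e.,
   the series converges unconditionally. *)
Definition real_analytic n (f : 'rV[R]_n -> R) : Prop :=
  forall a, exists c : {ffun 'I_n -> nat} -> R,
    \forall x \near a, partial_sum (power_term c a x) @ totally --> f x.

Definition clifford_analytic n m (f : 'rV[R]_n -> clifford R m) : Prop :=
  forall A, real_analytic (fun x => clifford_coord (f x) A).

Definition partial_derivative n (j : 'I_n) (g : 'rV[R]_n -> R) : 'rV[R]_n -> R :=
  fun x => 'D_(delta_mx 0 j) g x.

Definition laplacian n (g : 'rV[R]_n -> R) (x : 'rV[R]_n) : R :=
  \sum_(j < n) partial_derivative j (partial_derivative j g) x.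

(* At points with zero vector part, oddness of beta makes the second term
   vanish, whatever the value of the quotient. *)
Definition axial m (f : 'rV[R]_m.+1 -> clifford R m) : Prop :=
  exists alpha beta : R -> R -> clifford R m,
    [/\ clifford_analytic (fun p : 'rV[R]_2 => alpha (p 0 0) (p 0 1)),
        clifford_analytic (fun p : 'rV[R]_2 => beta (p 0 0) (p 0 1)),
        forall u v, alpha u (- v) = alpha u v,
        forall u v, beta u (- v) = - beta u v &
        forall x, f x = alpha (scalar_part x) (vector_part_norm x) +
          ((vector_part_norm x)^-1 *: vector_part x) *
            beta (scalar_part x) (vector_part_norm x)].

Definition axially_harmonic m (f : 'rV[R]_m.+1 -> clifford R m) : Prop :=
  [/\ clifford_analytic f, axial f &
      forall A x, laplacian (fun y => clifford_coord (f y) A) x = 0].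

(* Euler's integral, meaningful for a > 0 only. *)
Definition Gamma (a : R) : R :=
  \int[lebesgue_measure]_(t in `]0, +oo[) (t `^ (a - 1) * expR (- t)).

Definition pochhammer (a : R) (s : nat) : R := Gamma (a + s%:R) / Gamma a.

Definition T_formula (k s : nat) (t : R) : R :=
  'C(k, s)%:R *
  (pochhammer ((t - 1) / 2) (k - s) * pochhammer ((t - 1) / 2) s /
   pochhammer (t - 1) k).

(* For m = 1 the formula is of the form 0/0 (and Gamma has a pole at 0); it is
   then read as its limit, taken from the right so that all the arguments of
   Gamma are positive. *)
Definition T_coef (k s m : nat) : R :=
  if m == 1%N then lim (T_formula k s t @[t --> 1^'+])
  else T_formula k s m%:R.

Definition P_poly (k m : nat) (x : 'rV[R]_m.+1) : clifford R m :=
  \sum_(s < k.+1)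
    T_coef k s m *: (paravector x ^+ (k - s) * paravector_conj x ^+ s).

End AxiallyHarmonic.

(* Main.v *)
(* P_k is scalar valued: it is a polynomial in x_0 and |x|^2.  Indeed the
   coefficients T_s^k(t) satisfy a three-term recurrence in k whose
   denominators do not vanish at t = 1 (so that the limit defining the
   coefficients for m = 1 satisfies it too), and since x and its conjugate
   commute, with sum 2 x_0 and product |x|^2, it becomes the Gegenbauer
   recurrence
     (k + m) P_{k+2} = (2k + 1 + m) x_0 P_{k+1} - (k + 1) |x|^2 P_k.
   From it, dP_k/dx_0 = k P_{k-1} follows by induction, and then, P_k being
   homogeneous of degree k, so does the vanishing of the Laplacian of P_k. *)
From mathcomp Require Import finmap.
Require Import Defs.
From mathcomp Require Import all_boot all_order all_algebra.
From mathcomp Require Import all_classical all_reals all_analysis.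
From mathcomp.analysis.showcase Require Import summability.
From mathcomp Require Import measurable_realfun.
From mathcomp Require Import ring lra.

Set Implicit Arguments.
Unset Strict Implicit.
Unset Printing Implicit Defensive.

Import Order.TTheory GRing.Theory Num.Theory.
Import numFieldNormedType.Exports.

Local Open Scope classical_set_scope.
Local Open Scope ring_scope.

(** * The Gamma function *)

Section GammaFunction.
Context {R : realType}.
Implicit Types (a t : R) (n : nat).
Local Notation mu := (@lebesgue_measure R).

Let integrand a t : R := t `^ (a - 1) * expR (- t).

(** Counting from 2 keeps the two endpoints distinct and in order already at [n = 0]. All the
    segments stay away from 0 and together they exhaust the open half-line. *)
Let segment n : set R := `[n.+2%:R^-1, n.+2%:R].

Let segment_lt n : n.+2%:R^-1 < n.+2%:R :> R.
Proof. by apply: (@le_lt_trans _ _ 1); rewrite ?invf_le1 // ?ler1n ?ltr1n. Qed.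

Let bigcup_segment : \bigcup_n segment n = `]0, +oo[%classic.
Proof.
apply/seteqP; split => [t [n _]|t]; rewrite /segment /= !in_itv/= andbT.
  by case/andP => t0 _; apply: lt_le_trans t0; rewrite invr_gt0.
move=> t0; have [n tn] : exists n, t + t^-1 <= n%:R.
  by exists (Num.truncn (t + t^-1)).+1; apply: ltW; exact: truncnS_gt.
have tV0 : 0 < t^-1 by rewrite invr_gt0.
have nS : n%:R <= n.+2%:R :> R by rewrite ler_nat ltnW.
exists n => //=; rewrite in_itv/=; apply/andP; split; last lra.
by rewrite -[leRHS]invrK lef_pV2 ?posrE//; lra.
Qed.

Let segment_nondecreasing : nondecreasing_seq segment.
Proof.
move=> n p np; apply/subsetPset => t; rewrite /segment /= !in_itv/=.
move=> /andP[nt tn]; apply/andP; split.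
  by apply: le_trans nt; rewrite lef_pV2 ?posrE// ler_nat !ltnS.
by apply: le_trans tn _; rewrite ler_nat !ltnS.
Qed.

Let integrand_ge0 a t : 0 <= integrand a t.
Proof. by rewrite mulr_ge0 ?powR_ge0 ?expR_ge0. Qed.

Let measurable_integrand a (D : set R) : measurable_fun D (integrand a).
Proof.
apply: measurable_funTS; apply: measurable_funM.
  exact: measurable_powR.
by apply: measurableT_comp => //; exact: oppr_measurable.
Qed.

Let cvg_segment a : (\int[mu]_(t in segment n) (integrand a t)%:E @[n --> \oo]
  --> \int[mu]_(t in `]0%R, +oo[) (integrand a t)%:E)%E.
Proof.
rewrite -bigcup_segment; apply: ge0_nondecreasing_set_cvg_integral => //.
- by move=> n; exact: measurable_itv.
- by move=> n; apply/measurable_EFinP; exact: measurable_integrand.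
- by move=> n x _; rewrite lee_fin.
Qed.

(** * Integration by parts on the segments, and its boundary terms *)

Let continuous_powR a t : 0 < t -> {for t, continuous (fun t : R => t `^ a)}.
Proof.
move=> t0; apply: differentiable_continuous; apply/derivable1_diffP.
by apply: derivable_powR; rewrite in_itv/= t0.
Qed.

Let continuous_expRN t : {for t, continuous (fun t : R => expR (- t))}.
Proof.
by apply: continuous_comp; [exact: opp_continuous|exact: continuous_expR].
Qed.

Let is_derive_NexpRN t : is_derive t 1 (fun t : R => - expR (- t)) (expR (- t)).
Proof.
by apply: is_derive_eq; rewrite mulrN1 opprK.
Qed.

Let boundary a t : R := t `^ a * expR (- t).

(** The power is differentiated and the exponential integrated. Away from 0 all the functions
    involved are continuous, whatever the sign of [a]. *)
Let integration_by_parts_segment n a :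
  (\int[mu]_(t in segment n) (integrand (a + 1) t)%:E =
   (boundary a n.+2%:R^-1 - boundary a n.+2%:R)%:E +
   a%:E * \int[mu]_(t in segment n) (integrand a t)%:E)%E.
Proof.
have pos t : t \in (`[n.+2%:R^-1, n.+2%:R] : interval R) -> 0 < t.
  by rewrite in_itv/= => /andP[+ _]; apply: lt_le_trans; rewrite invr_gt0.
have posoo t : t \in (`]n.+2%:R^-1, n.+2%:R[ : interval R) -> 0 < t.
  by move=> /subset_itv_oo_cc; exact: pos.
under eq_integral do rewrite /integrand addrK.
rewrite (@integration_by_parts _ (fun t => t `^ a) (fun t => - expR (- t))
  (fun t => a * t `^ (a - 1)) (fun t => expR (- t))) //.
- rewrite !mulrN opprK [- _ + _]addrC; congr (_ + _)%E.
  transitivity (- \int[mu]_(t in segment n) ((- a)%:E * (integrand a t)%:E))%E.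
    by congr (- _)%E; apply: eq_integral => t _; rewrite -EFinM; congr EFin;
      rewrite /integrand; ring.
  rewrite integralZl//= ?EFinN ?mulNe ?oppeK//.
    exact: measurable_itv.
  apply: (@continuous_compact_integrable R (integrand a)).
    exact: segment_compact.
  apply: continuous_in_subspaceT => t /set_mem /pos t0.
  by apply: cvgM; [exact: continuous_powR|exact: continuous_expRN].
- apply: continuous_in_subspaceT => t /set_mem /pos t0.
  by apply: cvgM; [exact: cvg_cst|exact: continuous_powR].
- split.
  + by move=> t /posoo t0; apply: derivable_powR; rewrite in_itv/= t0.
  + by apply: cvg_at_right_filter; apply: continuous_powR; rewrite invr_gt0.
  + by apply: cvg_at_left_filter; apply: continuous_powR.
- by move=> t /posoo t0; rewrite powR_derive1// in_itv/= t0.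
- by apply: continuous_in_subspaceT => t _; exact: continuous_expRN.
- split.
  + by move=> t _; case: (is_derive_NexpRN t).
  + by apply: cvg_at_right_filter; apply: cvgN; exact: continuous_expRN.
  + by apply: cvg_at_left_filter; apply: cvgN; exact: continuous_expRN.
- by move=> t _; rewrite derive1E; case: (is_derive_NexpRN t).
Qed.

Let natSSy : n.+2%:R @[n --> \oo] --> (+oo : set_system R).
Proof.
have := @cvgr_idn R; rewrite -(cvg_shiftn 2 (fun n => n%:R : R)).
by under eq_fun do rewrite addn2.
Qed.

Let cvg_boundary0 a : 0 < a -> boundary a n.+2%:R^-1 @[n --> \oo] --> (0:R).
Proof.
move=> a0.
have : boundary a t @[t --> 0^'+] --> (0 * expR (- 0) : R).
  apply: cvgM; first exact: powR_cvg0.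
  by apply: cvg_at_right_filter; exact: continuous_expRN.
rewrite mul0r => /cvg_at_rightP.
apply; split; first by move=> n; rewrite invr_gt0.
by apply/gtr0_cvgV0 => //; near=> n; rewrite ltr0n.
Unshelve. all: end_near. Qed.

(** With [p] the integer part of [a], the term of degree [p + 2] of the exponential series bounds
    [boundary a t] by [(p + 2)! / t] for [t >= 1]. *)
Let boundary_cvgy a : 0 < a -> boundary a t @[t --> +oo] --> (0:R).
Proof.
move=> a0; set p := Num.truncn a.
have pa : a <= p.+1%:R by exact/ltW/truncnS_gt.
have cst_div : (p.+2`!%:R / t : R) @[t --> +oo] --> (0:R).
  rewrite -(mulr0 p.+2`!%:R); apply: cvgM; first exact: cvg_cst.
  by apply/gtr0_cvgV0 => //; exact: nbhs_pinfty_gt.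
apply: (@squeeze_cvgr _ _ _ _ (fun=> 0) (fun t => p.+2`!%:R / t)) => //;
  last exact: cvg_cst.
near=> t.
have t1 : 1 <= t by near: t; exact: nbhs_pinfty_ge.
have t0 : 0 < t by exact: lt_le_trans t1.
rewrite mulr_ge0 ?powR_ge0 ?expR_ge0//=.
rewrite /boundary expRN ler_pdivrMr ?expR_gt0// mulrAC ler_pdivlMr//.
apply: (@le_trans _ _ (t ^+ p.+2)).
  rewrite exprSr ler_wpM2r ?(ltW t0)// -powR_mulrn ?(ltW t0)//.
  exact: ler_powR.
rewrite mulrC -ler_pdivrMr ?ltr0n ?fact_gt0//.
by apply: le_trans (expR_ge1Dxn p.+1 (ltW t0)); rewrite lerDr.
Unshelve. all: end_near. Qed.

Let cvg_boundaryy a : 0 < a -> boundary a n.+2%:R @[n --> \oo] --> (0:R).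
Proof.
by move=> a0;
  exact: (@cvg_comp _ _ _ (fun n => n.+2%:R : R) (boundary a) _ _ _ natSSy
    (boundary_cvgy a0)).
Qed.

(** The identity on segments is passed to the limit in the extended reals. The boundary terms tend
    to 0, so the sum of limits is well defined even before the integral is known to be finite;
    finiteness is then deduced from this very identity. *)
Let integralD1 a : 0 < a ->
  (\int[mu]_(t in `]0%R, +oo[) (integrand (a + 1) t)%:E =
   a%:E * \int[mu]_(t in `]0%R, +oo[) (integrand a t)%:E)%E.
Proof.
move=> a0; have /(_ (a + 1))/cvg_lim <- // := cvg_segment.
apply: cvg_lim => //; under eq_fun do rewrite integration_by_parts_segment.
rewrite -[(_ * _)%E]add0e; apply: cvgeD => //.
- apply: cvg_EFin; first by near=> n.
  rewrite -(subr0 0).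
  by apply: cvgB; [exact: cvg_boundary0|exact: cvg_boundaryy].
- exact: cvgeZl.
Unshelve. all: end_near. Qed.

(** * Finiteness and positivity of Euler's integral *)

Let integral_ge0 a : (0 <= \int[mu]_(t in `]0%R, +oo[) (integrand a t)%:E)%E.
Proof. by apply: integral_ge0 => t _; rewrite lee_fin. Qed.

(** For [a = 1] the integrand is the density of the exponential law of rate 1 on the half-line. *)
Let integral1 : (\int[mu]_(t in `]0%R, +oo[) (integrand 1 t)%:E < +oo)%E.
Proof.
have /(le_lt_trans _) : (\int[mu]_t (exponential_pdf 1 t)%:E < +oo)%E.
  by rewrite integral_exponential_pdf // ltry.
apply; apply: le_trans (@ge0_subset_integral _ _ _ mu `]0%R, +oo[ setT _ _
  (fun t => (exponential_pdf 1 t)%:E) _ _ _) => //=.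
- rewrite le_eqVlt; apply/orP; left; apply/eqP; apply: eq_integral => t.
  rewrite inE/= in_itv/= andbT => t0; rewrite exponential_pdfE ?ltW//.
  by rewrite /integrand subrr powRr0 mulN1r.
- by apply/measurable_EFinP; exact: measurable_exponential_pdf.
- by move=> t _; rewrite lee_fin exponential_pdf_ge0.
Qed.

Let integral_natS n :
  (\int[mu]_(t in `]0%R, +oo[) (integrand n.+1%:R t)%:E < +oo)%E.
Proof.
elim: n => [//|n IHn]; rewrite -natr1 integralD1 ?ltr0n//.
by apply: lte_mul_pinfty.
Qed.

(** Passing to [a + 1] removes the possible singularity at 0, and [integralD1] carries finiteness
    back to [a]. *)
Let integral_lty a : 0 < a ->
  (\int[mu]_(t in `]0%R, +oo[) (integrand a t)%:E < +oo)%E.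
Proof.
move=> a0.
suff : (\int[mu]_(t in `]0%R, +oo[) (integrand (a + 1) t)%:E < +oo)%E.
  rewrite (integralD1 a0).
  case: (\int[mu]_(t in `]0%R, +oo[) _)%E => [r _| |_].
  - exact: ltry.
  - by rewrite gt0_muley.
  - by [].
set n := Num.truncn a.
have na : a <= n.+1%:R by exact/ltW/truncnS_gt.
(* This rests on [t ^ a <= 1 + t ^ (n + 1)]: the first term suffices for [t <= 1], the second for
   [t > 1]. Both resulting integrals have a positive integer parameter. *)
have /le_lt_trans : (\int[mu]_(t in `]0%R, +oo[) (integrand (a + 1) t)%:E <=
    \int[mu]_(t in `]0%R, +oo[)
      ((integrand 1 t)%:E + (integrand n.+2%:R t)%:E))%E.
  apply: ge0_le_integral => //=.
  - by move=> t _; rewrite lee_fin.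
  - by apply/measurable_EFinP; exact: measurable_integrand.
  - by apply: emeasurable_funD; apply/measurable_EFinP;
      exact: measurable_integrand.
  - move=> t; rewrite in_itv/= andbT => t0; rewrite -EFinD lee_fin -mulrDl.
    rewrite ler_pM2r ?expR_gt0// subrr powRr0 addrK -natr1 addrK.
    have [t1|t1] := leP t 1.
      rewrite (@le_trans _ _ 1) ?lerDl ?powR_ge0//.
      have := ge0_ler_powR (ltW a0) (_ : t \is Num.nneg)
        (_ : 1 \is Num.nneg) t1.
      by rewrite powR1 !nnegrE; apply; rewrite ?ltW.
    by rewrite (le_trans (ler_powR (ltW t1) na))// lerDr.
apply; rewrite ge0_integralD.
- by apply: lte_add_pinfty; [exact: integral1|exact: integral_natS].
- exact: measurable_itv.
- by move=> t _; rewrite lee_fin.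
- by apply/measurable_EFinP; exact: measurable_integrand.
- by move=> t _; rewrite lee_fin.
- by apply/measurable_EFinP; exact: measurable_integrand.
Qed.

(** At [a + 1] the power is at least 1 on [[1, 2]], so the integrand is bounded below there by
    [exp(-2)]. *)
Let integral_gt0 a : 0 < a ->
  (0 < \int[mu]_(t in `]0%R, +oo[) (integrand a t)%:E)%E.
Proof.
move=> a0; suff : (0 < \int[mu]_(t in `]0%R, +oo[) (integrand (a + 1) t)%:E)%E.
  by rewrite integralD1// pmule_rgt0.
apply: (@lt_le_trans _ _
  (\int[mu]_(t in `[1%R, 2%R]) (cst (expR (- 2))%:E t))%E).
  rewrite integral_cst//= [X in (_ * X)%E](lebesgue_measure_itv `[1%R, 2%R]).
  by rewrite /= lte_fin ltr1n mule_gt0 ?lte_fin ?expR_gt0.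
apply: (@le_trans _ _ (\int[mu]_(t in `[1%R, 2%R]) (integrand (a + 1) t)%:E)%E).
  apply: ge0_le_integral => //=.
  - by apply/measurable_EFinP; exact: measurable_integrand.
  - move=> t; rewrite in_itv/= => /andP[t1 t2]; rewrite lee_fin -[leLHS]mul1r.
    rewrite ler_pM ?expR_ge0// ?ler_expR ?lerN2// addrK.
    by rewrite -(powRr0 t) ler_powR// ltW.
apply: ge0_subset_integral => //=.
- by apply/measurable_EFinP; exact: measurable_integrand.
- by move=> t _; rewrite lee_fin.
- by move=> t; rewrite /= !in_itv/= andbT => /andP[t1 _]; apply: lt_le_trans t1.
Qed.

Lemma Gamma_gt0 a : 0 < a -> 0 < Gamma a.
Proof.
move=> a0; apply: fine_gt0; apply/andP.
by split; [exact: integral_gt0|exact: integral_lty].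
Qed.

(** [Gamma] is the real part of an extended real integral, and taking it respects products of finite
    values; hence the use of [integral_lty]. *)
Lemma GammaD1 a : 0 < a -> Gamma (a + 1) = a * Gamma a.
Proof.
move=> a0; rewrite /Gamma /Rintegral integralD1// fineM//.
by rewrite ge0_fin_numE; [exact: integral_lty|exact: integral_ge0].
Qed.

End GammaFunction.

(** * The coefficients *)

Section Coefficients.
Context {R : realType}.
Implicit Types (a t : R) (k s : nat).

Lemma pochhammer0 a : 0 < a -> pochhammer a 0 = 1.
Proof. by move=> a0; rewrite /pochhammer addr0 divff// gt_eqF// Gamma_gt0. Qed.

Lemma pochhammerS a s : 0 < a ->
  pochhammer a s.+1 = pochhammer a s * (a + s%:R).
Proof.
move=> a0; rewrite /pochhammer -natr1 addrA GammaD1 ?ltr_wpDr//.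
by rewrite -mulrA mulrC.
Qed.

Lemma pochhammer_gt0 a s : 0 < a -> 0 < pochhammer a s.
Proof. by move=> a0; rewrite divr_gt0 ?Gamma_gt0 ?ltr_wpDr. Qed.

(** The recurrence [(k + t) P_{k+2} = (2k + 1 + t) u P_{k+1} - (k + 1) q P_k], with
    [u = (X + Y) / 2] and [q = X Y], read on the coefficients of [X^(k-s) Y^s]. The conditionals on
    [s] encode multiplication by [Y]. Unlike [T_formula], this is regular at [t = 1]. *)
Fixpoint zonal_coef t k : nat -> R :=
  match k with
  | 0 => fun s => (s == 0)%:R
  | 1 => fun s => (s <= 1)%:R / 2
  | (k1.+1 as k2).+1 => fun s =>
      (((2 * k1 + 1)%:R + t) / 2 *
         (zonal_coef t k2 s + (if s is s1.+1 then zonal_coef t k2 s1 else 0)) -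
       k1.+1%:R * (if s is s1.+1 then zonal_coef t k1 s1 else 0)) / (k1%:R + t)
  end.

Lemma zonal_coefSS t k s : zonal_coef t k.+2 s =
  (((2 * k + 1)%:R + t) / 2 *
     (zonal_coef t k.+1 s + (if s is s1.+1 then zonal_coef t k.+1 s1 else 0)) -
   k.+1%:R * (if s is s1.+1 then zonal_coef t k s1 else 0)) / (k%:R + t).
Proof. by []. Qed.

Lemma zonal_coef_gt t k s : (k < s)%N -> zonal_coef t k s = 0.
Proof.
elim/ltn_ind: k s => -[|[|k]] IHk [|s] // ks.
  by rewrite /= leqNgt ks mul0r.
by rewrite zonal_coefSS !IHk // ?addr0 ?mulr0 ?subrr ?mul0r // ltnW.
Qed.

(** With [a = (t - 1) / 2] and [h i = (a)_i / i!], the coefficient is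
    [k! / (t - 1)_k * h (k - s) * h s]. All terms of the recurrence are then rational multiples of
    one product of values of [h], and a rational identity remains. *)
Lemma T_formula_zonal k s t : 1 < t -> T_formula k s t = zonal_coef t k s.
Proof.
(* Keeping [a] opaque and writing [t = 2 * a + 1] lets [field] work with [a] as an indeterminate. *)
move=> t1; have [a aE] : {a | (t - 1) / 2 = a} by exists ((t - 1) / 2).
have a0 : 0 < a by lra.
have t10 : 0 < t - 1 by lra.
have ta : t = 2 * a + 1 by rewrite -aE; field.
(* h i = (a)_i / i`! are the Taylor coefficients of (1 - z)^(-a). *)
pose h i : R := pochhammer a i / i`!%:R.
have h0 : h 0 = 1 by rewrite /h pochhammer0 // divr1.
have hS i : h i.+1 = h i * (a + i%:R) / i.+1%:R.
  rewrite /h pochhammerS// factS natrM; field.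
  by rewrite addrC natr1 !pnatr_eq0 -!lt0n fact_gt0.
have f0 i : i`!%:R != 0 :> R by rewrite pnatr_eq0 -lt0n fact_gt0.
have D0 p : pochhammer (t - 1) p != 0 by rewrite gt_eqF// pochhammer_gt0.
have TE j i : T_formula (i + j) j t =
    (i + j)`!%:R / pochhammer (t - 1) (i + j) * (h i * h j).
  rewrite /T_formula addnK aE /h -(@bin_fact (i + j) j) ?leq_addl// addnK.
  rewrite !natrM; have := D0 (i + j)%N; have := f0 i; have := f0 j.
  move: (i`!%:R) (j`!%:R) (pochhammer _ (i + j)) 'C(_, _)%:R (pochhammer a i)
    (pochhammer a j) => /= fi fj D c p q fj0 fi0 DN0; field.
  by rewrite fi0 fj0 DN0.
have T0 p j : (p < j)%N -> T_formula p j t = 0.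
  by move=> pj; rewrite /T_formula bin_small// mul0r.
have TE0 p : T_formula p 0 t = p`!%:R / pochhammer (t - 1) p * h p.
  by have := TE 0%N p; rewrite addn0 h0 mulr1.
have TEp p : T_formula p p t = p`!%:R / pochhammer (t - 1) p * h p.
  by have := TE p 0%N; rewrite add0n h0 mul1r.
elim/ltn_ind: k s => -[|[|k]] IHk s.
- case: s => [|s]; last by rewrite T0.
  by rewrite TE0 h0 pochhammer0// !divr1 mulr1.
- case: s => [|[|s]]; last by rewrite T0//= mul0r.
    rewrite TE0 hS h0 pochhammerS// pochhammer0// ta (factS 0) fact0 /=.
    by field; lra.
  rewrite TEp hS h0 pochhammerS// pochhammer0// ta (factS 0) fact0 /=.
  by field; lra.
have k0 : 0 <= k%:R :> R by [].
have DS p : pochhammer (t - 1) p.+1 = pochhammer (t - 1) p * (2 * a + p%:R).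
  by rewrite pochhammerS// ta addrK.
have DSS : pochhammer (t - 1) k.+2 =
    pochhammer (t - 1) k * (2 * a + k%:R) * (2 * a + k%:R + 1).
  by rewrite !DS -[k.+1%:R]natr1 addrA.
have fS p : p.+1`!%:R = (p%:R + 1) * p`!%:R :> R by rewrite factS natrM -natr1.
case: s => [|s].
  rewrite zonal_coefSS -!IHk// addr0 mulr0 subr0 !TE0 hS DSS DS !fS.
  have := D0 k; move: (pochhammer _ _) k`!%:R (h _) => D f x D'.
  rewrite natrD natrM -![_.+1%:R]natr1 ta; move: k%:R k0 => p p0.
  by clear -a0 p0 D'; field; rewrite D'; lra.
(* The index is now [s + 1]. At the top index [k + 2] only the term shifted from degree [k + 1]
   survives; above it every term vanishes. *)
rewrite zonal_coefSS -!IHk//; have [sk|] := ltnP s k.+1; last first.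
  rewrite leq_eqVlt => /predU1P[<-|ks]; last first.
    by rewrite !T0 ?addr0 ?mulr0 ?subrr ?mul0r// ltnW.
  rewrite [T_formula k.+1 k.+2 t]T0// [T_formula k k.+1 t]T0// !TEp.
  rewrite hS DSS DS !fS.
  have := D0 k; move: (pochhammer _ _) k`!%:R (h _) => D f x D'.
  rewrite natrD natrM -![_.+1%:R]natr1 ta; move: k%:R k0 => p p0.
  by clear -a0 p0 D'; field; rewrite D'; lra.
(* In the interior [k = i + s], which avoids truncated subtraction; all four coefficients reduce to
   [h i * h s]. *)
have [i ki] : {i | k = (i + s)%N} by exists (k - s)%N; rewrite subnK.
have e1 : k.+2 = (i.+1 + s.+1)%N by rewrite ki addSn addnS.
have e2 : k.+1 = (i + s.+1)%N by rewrite ki addnS.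
have e3 : k.+1 = (i.+1 + s)%N by rewrite ki addSn.
have Ts2 : T_formula k.+2 s.+1 t =
    k.+2`!%:R / pochhammer (t - 1) k.+2 * (h i.+1 * h s.+1) by rewrite e1 TE.
have Ts1 : T_formula k.+1 s.+1 t =
    k.+1`!%:R / pochhammer (t - 1) k.+1 * (h i * h s.+1) by rewrite e2 TE.
have Ts1' : T_formula k.+1 s t =
    k.+1`!%:R / pochhammer (t - 1) k.+1 * (h i.+1 * h s) by rewrite e3 TE.
have Ts0 : T_formula k s t =
    k`!%:R / pochhammer (t - 1) k * (h i * h s) by rewrite ki TE.
rewrite Ts2 Ts1 Ts1' Ts0 !hS DSS DS !fS.
have := D0 k; move: (pochhammer _ _) k`!%:R (h i) (h s) => D f x y D'.
have kis : k%:R = i%:R + s%:R :> R by rewrite ki natrD.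
have i0 : 0 <= i%:R :> R by [].
have s0 : 0 <= s%:R :> R by [].
rewrite natrD natrM -![_.+1%:R]natr1 kis ta.
move: i%:R s%:R i0 s0 => p q p0 q0.
by clear -a0 p0 q0 D'; field; rewrite D'; lra.
Qed.

(** For [t > 0] no denominator [k + t] vanishes. Used at [t = 1], where it gives the limiting value
    of the coefficients. *)
Lemma continuous_zonal_coef k s t : 0 < t ->
  zonal_coef x k s @[x --> t] --> zonal_coef t k s.
Proof.
move=> t0; elim/ltn_ind: k s => -[|[|k]] IHk s; try exact: cvg_cst.
have IH' p : (p < k.+2)%N ->
    (if s is s1.+1 then zonal_coef x p s1 else 0) @[x --> t] -->
    (if s is s1.+1 then zonal_coef t p s1 else 0).
  by move=> pk; case: s => [|s]; [exact: cvg_cst|exact: IHk].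
rewrite zonal_coefSS; under eq_fun do rewrite zonal_coefSS.
apply: cvgM; last first.
  apply: cvgV; first by rewrite gt_eqF// ltr_wpDl.
  by apply: cvgD; [exact: cvg_cst|exact: cvg_id].
apply: cvgB; apply: cvgM.
- by apply: cvgM; [apply: cvgD; [exact: cvg_cst|exact: cvg_id]|exact: cvg_cst].
- by apply: cvgD; [exact: IHk|exact: IH'].
- exact: cvg_cst.
- exact: IH'.
Qed.

Lemma T_coefE k s m : (0 < m)%N -> T_coef R k s m = zonal_coef m%:R k s.
Proof.
move=> m0; rewrite /T_coef; case: eqVneq => [->|m1]; last first.
  by rewrite T_formula_zonal// ltr1n ltn_neqAle eq_sym m1.
apply: cvg_lim => //.
(* To the right of 1 the formula and the recurrence agree, so they have the same limit. *)
apply: (@cvg_trans _ (zonal_coef t k s @[t --> 1^'+])).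
  apply: near_eq_cvg; near=> t; rewrite T_formula_zonal//.
apply: cvg_at_right_filter; exact: continuous_zonal_coef.
Unshelve. all: end_near. Qed.

End Coefficients.

(** * Gegenbauer polynomials of a paravector *)

Section ZonalPolynomial.
Context {R : realType}.
Implicit Types (t u q : R) (k m : nat).

(** For [t > 1] this is the Gegenbauer polynomial of index [(t - 1) / 2], homogenised by [q] and
    normalised to be 1 at [u = q = 1]; for [t = 1] it is the Chebyshev polynomial of the first kind,
    homogenised likewise. *)
Fixpoint zonal t u q k : R :=
  match k with
  | 0 => 1
  | 1 => u
  | (k1.+1 as k2).+1 =>
      (((2 * k1 + 1)%:R + t) * (u * zonal t u q k2) -
       k1.+1%:R * (q * zonal t u q k1)) / (k1%:R + t)
  end.

Lemma zonalSS t u q k : zonal t u q k.+2 =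
  (((2 * k + 1)%:R + t) * (u * zonal t u q k.+1) -
   k.+1%:R * (q * zonal t u q k)) / (k%:R + t).
Proof. by []. Qed.

Section HomogeneousSum.
Variables (A : algType R) (X Y : A).
Implicit Types (f g : nat -> R).

Definition homogeneous_sum f k : A :=
  \sum_(s < k.+1) f s *: (X ^+ (k - s) * Y ^+ s).

(** The effect on coefficients of multiplying by [Y]. *)
Definition shift f s : R := if s is s1.+1 then f s1 else 0.

Lemma homogeneous_sumB f g k :
  homogeneous_sum (fun s => f s - g s) k =
  homogeneous_sum f k - homogeneous_sum g k.
Proof. by rewrite -sumrB; apply: eq_bigr => s _; rewrite scalerBl. Qed.

Lemma homogeneous_sumD f g k :
  homogeneous_sum (fun s => f s + g s) k =
  homogeneous_sum f k + homogeneous_sum g k.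
Proof. by rewrite -big_split; apply: eq_bigr => s _; rewrite scalerDl. Qed.

Lemma homogeneous_sumZ c f k :
  homogeneous_sum (fun s => c * f s) k = c *: homogeneous_sum f k.
Proof. by rewrite scaler_sumr; apply: eq_bigr => s _; rewrite scalerA. Qed.

(** Multiplying by [X] raises the degree and leaves the coefficients in place; the added top
    coefficient has to be zero. *)
Lemma homogeneous_sumXl f k : f k.+1 = 0 ->
  homogeneous_sum f k.+1 = X * homogeneous_sum f k.
Proof.
move=> fk; rewrite /homogeneous_sum big_ord_recr /= fk scale0r addr0 mulr_sumr.
apply: eq_bigr => s _; rewrite -scalerAr mulrA -exprS subSn//.
by rewrite -ltnS.
Qed.

Lemma homogeneous_sumYl f k : GRing.comm X Y ->
  homogeneous_sum (shift f) k.+1 = Y * homogeneous_sum f k.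
Proof.
move=> XY; rewrite /homogeneous_sum big_ord_recl /= scale0r add0r mulr_sumr.
apply: eq_bigr => s _; rewrite -scalerAr exprS !mulrA.
by congr (_ *: (_ * _)); rewrite subSS; apply/commr_sym/commrX/commr_sym.
Qed.

Lemma homogeneous_sum_zonal t u q k : GRing.comm X Y ->
  X + Y = (2 * u)%:A -> X * Y = q%:A ->
  homogeneous_sum (zonal_coef t k) k = (zonal t u q k)%:A.
Proof.
move=> XYC XDY XMY; elim/ltn_ind: k => -[|[|k]] IHk.
- by rewrite /homogeneous_sum big_ord1 /= mulr1.
- rewrite /homogeneous_sum big_ord_recr big_ord1 /= mulr1 mul1r -scalerDr.
  rewrite subn0 subnn expr0 mul1r !expr1 XDY.
  by rewrite scalerA mulrA mulVf// mul1r.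
have -> : homogeneous_sum (zonal_coef t k.+2) k.+2 = homogeneous_sum (fun s =>
    (k%:R + t)^-1 * (((2 * k + 1)%:R + t) / 2 *
      (zonal_coef t k.+1 s + shift (zonal_coef t k.+1) s) -
    k.+1%:R * shift (zonal_coef t k) s)) k.+2.
  by apply: eq_bigr => s _; rewrite zonal_coefSS [in LHS]mulrC.
rewrite homogeneous_sumZ homogeneous_sumB !homogeneous_sumZ homogeneous_sumD.
rewrite homogeneous_sumXl ?zonal_coef_gt// !homogeneous_sumYl// -mulrDl XDY.
(* The last term gains two degrees: one factor [Y] from the shift and one factor [X] from here,
   whose product is [q]. *)
rewrite [homogeneous_sum (zonal_coef t k) k.+1]homogeneous_sumXl;
  last exact: zonal_coef_gt.
rewrite mulrA -XYC XMY !IHk// -!scalerAl !mul1r !scalerA.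
rewrite -scalerBl scalerA zonalSS; congr (_ *: _).
by rewrite [RHS]mulrC; congr (_ * (_ - _)); rewrite ?mulrA ?mulfVK//; field.
Qed.

End HomogeneousSum.

(** * A paravector and its conjugate *)

Lemma commr_paravector m (x : 'rV[R]_m.+1) :
  GRing.comm (paravector x) (paravector_conj x).
Proof.
apply: commrB; apply/commr_sym.
  by rewrite /GRing.comm -scalerAl -scalerAr mul1r mulr1.
by apply: commrD => //; rewrite /GRing.comm -scalerAl -scalerAr mul1r mulr1.
Qed.

Lemma paravectorD_conj m (x : 'rV[R]_m.+1) :
  paravector x + paravector_conj x = (2 * x 0 0)%:A.
Proof.
by rewrite addrACA subrr addr0 -scalerDl /scalar_part -mulr2n mulr_natl.
Qed.

(** Twice the square is written as a double sum plus the same sum with indices exchanged. The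
    anticommutation relations then leave only the diagonal, and the factor 2 is cancelled. *)
Lemma vector_part_sqr m (x : 'rV[R]_m.+1) :
  vector_part x * vector_part x = - (\sum_(j < m) x 0 (lift ord0 j) ^+ 2)%:A.
Proof.
set y := fun j : 'I_m => x 0 (lift ord0 j).
pose e := clifford_gen R (m := m).
have VV : vector_part x * vector_part x =
    \sum_i \sum_j (y i * y j) *: (e i * e j).
  rewrite mulr_suml; apply: eq_bigr => i _; rewrite mulr_sumr.
  by apply: eq_bigr => j _; rewrite -scalerAl -scalerAr scalerA.
have V2 : vector_part x * vector_part x + vector_part x * vector_part x =
    \sum_i \sum_j (y i * y j) *: (- 2 * (i == j)%:R)%:A.
  rewrite VV [X in X + _]exchange_big -big_split /=; apply: eq_bigr => i _.
  rewrite -big_split; apply: eq_bigr => j _ /=; rewrite [y j * y i]mulrC.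
  by rewrite -scalerDr addrC clifford_genM.
apply: (@scalerI _ _ 2); first by rewrite pnatr_eq0.
rewrite scaler_nat mulr2n V2 scalerN scalerA -scaleNr mulr_sumr -sumrN.
rewrite scaler_suml.
apply: eq_bigr => i _; rewrite (bigD1 i)//= big1 ?addr0 => [|j ji].
  by rewrite eqxx scalerA mulr1; congr (_ *: _); rewrite /y; ring.
by rewrite eq_sym (negPf ji) mulr0 scale0r scaler0.
Qed.

Lemma paravectorM_conj m (x : 'rV[R]_m.+1) :
  paravector x * paravector_conj x = (\sum_j x 0 j ^+ 2)%:A.
Proof.
rewrite big_ord_recl scalerDl.
rewrite -[X in _ + X]opprK -vector_part_sqr /paravector /paravector_conj.
rewrite mulrDl !mulrBr -!scalerAl -!scalerAr !mul1r mulr1 scalerA expr2.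
by rewrite addrA subrK.
Qed.

(** From here on the Clifford product is no longer involved: only a real polynomial has to be
    studied. *)
Lemma P_polyE k m (x : 'rV[R]_m.+1) : (0 < m)%N ->
  P_poly k x = (zonal m%:R (x 0 0) (\sum_j x 0 j ^+ 2) k)%:A.
Proof.
move=> m0.
rewrite -(@homogeneous_sum_zonal _ (paravector x) (paravector_conj x)).
- by apply: eq_bigr => s _; rewrite T_coefE.
- exact: commr_paravector.
- exact: paravectorD_conj.
- exact: paravectorM_conj.
Qed.

End ZonalPolynomial.

(** * Polynomial functions of several variables *)

Section PolynomialFunctions.
Context {R : realType} {n : nat}.
Implicit Types (f g : 'rV[R]_n -> R) (a x v : 'rV[R]_n) (i j : 'I_n).

(** An inductive predicate on functions makes derivability, and stability under partial derivatives,
    plain structural inductions. *)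
Inductive polynomial_fun : ('rV[R]_n -> R) -> Prop :=
| polynomial_fun_cst c : polynomial_fun (fun=> c)
| polynomial_fun_coord i : polynomial_fun (fun x => x 0 i)
| polynomial_funD f g : polynomial_fun f -> polynomial_fun g ->
    polynomial_fun (fun x => f x + g x)
| polynomial_funM f g : polynomial_fun f -> polynomial_fun g ->
    polynomial_fun (fun x => f x * g x).

(** The list may repeat a multi-index, so sums are concatenations and products are lists over all
    pairs, with exponents added. *)
Lemma polynomial_fun_expansion f a : polynomial_fun f ->
  exists s : seq (R * {ffun 'I_n -> nat}), forall x,
    f x = \sum_(p <- s) p.1 * \prod_(i < n) (x 0 i - a 0 i) ^+ p.2 i.
Proof.
have cstE c x :
    \sum_(p <- [:: (c, [ffun=> 0%N] : {ffun 'I_n -> nat})])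
      p.1 * \prod_(i < n) (x 0 i - a 0 i) ^+ p.2 i = c.
  by rewrite big_seq1 big1 ?mulr1// => i _; rewrite ffunE.
elim=> {f} [c|i|f g _ [s fs] _ [r gr]|f g _ [s fs] _ [r gr]].
- by exists [:: (c, [ffun=> 0%N])] => x; rewrite cstE.
(* A coordinate is recentred as [a_i + (x_i - a_i)]. *)
- exists ([:: (a 0 i, [ffun=> 0%N])] ++
    [:: (1, [ffun j => (j == i) : nat])]) => x.
  rewrite big_cat cstE big_seq1 /= mul1r (bigD1 i)//= big1 => [|j ji].
    by rewrite ffunE eqxx mulr1 expr1 addrC subrK.
  by rewrite ffunE (negPf ji).
- by exists (s ++ r) => x; rewrite big_cat fs gr.
- exists [seq (p.1 * e.1, [ffun i => (p.2 i + e.2 i)%N])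
    | p : R * {ffun 'I_n -> nat} <- s, e : R * {ffun 'I_n -> nat} <- r] => x.
  rewrite big_allpairs_dep fs gr mulr_suml; apply: eq_bigr => p _.
  rewrite mulr_sumr; apply: eq_bigr => e _ /=; rewrite mulrACA; congr (_ * _).
  by rewrite -big_split; apply: eq_bigr => i _; rewrite ffunE exprD.
Qed.

Lemma polynomial_fun_analytic f : polynomial_fun f -> real_analytic f.
Proof.
move=> pf a; have [s fs] := polynomial_fun_expansion a pf.
(* Repeated multi-indices are collected into one coefficient. *)
exists (fun k => \sum_(p <- s | p.2 == k) p.1); near=> x.
have FF := @totally_filter {ffun 'I_n -> nat}.
(* Once a finite set contains every multi-index of the list, the partial sum equals [f x]. *)
apply: cvg_near_cst; exists (seq_fset tt [seq p.2 | p <- s]) => // B sB.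
rewrite fs /partial_sum /power_term.
under eq_bigr => k _ do rewrite mulr_suml.
rewrite (exchange_big_dep xpredT)//= big_seq [RHS]big_seq.
apply: eq_bigr => p ps; have pB : p.2 \in B.
  by apply: (fsubsetP sB); rewrite seq_fsetE map_f.
by rewrite (big_pred1 (FSetSub pB)).
Unshelve. all: end_near. Qed.

(** * Partial derivatives and Laplacians of polynomial functions *)

Lemma is_derive_coord i x v : is_derive x v (fun x => x 0 i) (v 0 i).
Proof.
apply: DeriveDef; first exact/diff_derivable/differentiable_coord.
apply: cvg_lim => //; apply: cvg_near_cst; near=> h.
rewrite /= !mxE addrK /GRing.scale/= mulrA mulVf ?mul1r//.
near: h; exact: nbhs_dnbhs_neq.
Unshelve. all: end_near. Qed.

Lemma polynomial_fun_derivable f x v : polynomial_fun f -> derivable f x v.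
Proof.
elim=> {f} [c|i|f g _ df _ dg|f g _ df _ dg].
- exact: derivable_cst.
- by case: (is_derive_coord i x v).
- exact: (derivableD df dg).
- exact: (derivableM df dg).
Qed.

Lemma partial_derivative_cst j c :
  partial_derivative j (fun=> c) = (fun=> 0) :> ('rV[R]_n -> R).
Proof. by apply/funext => x; exact: derive_cst. Qed.

Lemma partial_derivative_coord j i :
  partial_derivative j (fun x => x 0 i) = fun=> (i == j)%:R :> R.
Proof.
apply/funext => x; have [_] := is_derive_coord i x (delta_mx 0 j).
by rewrite mxE eqxx.
Qed.

(** Stated as an equality of functions, so that it can be rewritten inside a second derivative. *)
Lemma partial_derivativeD j f g : polynomial_fun f -> polynomial_fun g ->
  partial_derivative j (fun x => f x + g x) =
  fun x => partial_derivative j f x + partial_derivative j g x.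
Proof.
move=> pf pg; apply/funext => x.
by apply: deriveD; exact: polynomial_fun_derivable.
Qed.

Lemma partial_derivativeM j f g : polynomial_fun f -> polynomial_fun g ->
  partial_derivative j (fun x => f x * g x) =
  fun x => partial_derivative j f x * g x + f x * partial_derivative j g x.
Proof.
move=> pf pg; apply/funext => x; rewrite addrC [_ * g x]mulrC.
by apply: deriveM; exact: polynomial_fun_derivable.
Qed.

Lemma polynomial_fun_partial_derivative j f :
  polynomial_fun f -> polynomial_fun (partial_derivative j f).
Proof.
elim=> {f} [c|i|f g pf pdf pg pdg|f g pf pdf pg pdg].
- by rewrite partial_derivative_cst; constructor.
- by rewrite partial_derivative_coord; constructor.
- by rewrite partial_derivativeD//; constructor.
- by rewrite partial_derivativeM//; constructor; constructor.
Qed.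

Lemma partial_derivativeZ j c f : polynomial_fun f ->
  partial_derivative j (fun x => c * f x) =
  fun x => c * partial_derivative j f x.
Proof.
move=> pf; rewrite partial_derivativeM//; last by constructor.
by rewrite partial_derivative_cst; apply/funext => x; rewrite mul0r add0r.
Qed.

Lemma laplacian_cst c x : laplacian (fun=> c) x = 0.
Proof.
by rewrite /laplacian big1// => j _; rewrite !partial_derivative_cst.
Qed.

Lemma laplacian_coord i x : laplacian (fun x => x 0 i) x = 0.
Proof.
rewrite /laplacian big1// => j _.
by rewrite partial_derivative_coord partial_derivative_cst.
Qed.

Lemma laplacianD f g x : polynomial_fun f -> polynomial_fun g ->
  laplacian (fun x => f x + g x) x = laplacian f x + laplacian g x.
Proof.
move=> pf pg; rewrite -big_split; apply: eq_bigr => j _ /=.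
by rewrite !partial_derivativeD//; exact: polynomial_fun_partial_derivative.
Qed.

Lemma laplacianZ c f x : polynomial_fun f ->
  laplacian (fun x => c * f x) x = c * laplacian f x.
Proof.
move=> pf; rewrite mulr_sumr; apply: eq_bigr => j _.
by rewrite !partial_derivativeZ//; exact: polynomial_fun_partial_derivative.
Qed.

Lemma laplacianM f g x : polynomial_fun f -> polynomial_fun g ->
  laplacian (fun x => f x * g x) x = laplacian f x * g x + f x * laplacian g x +
    2 * \sum_j partial_derivative j f x * partial_derivative j g x.
Proof.
move=> pf pg; rewrite mulr_suml !mulr_sumr -!big_split.
apply: eq_bigr => j _ /=.
have pd h : polynomial_fun h -> polynomial_fun (partial_derivative j h).
  exact: polynomial_fun_partial_derivative.
rewrite (partial_derivativeM _ pf pg) partial_derivativeD.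
- rewrite (partial_derivativeM _ (pd _ pf) pg).
  rewrite (partial_derivativeM _ pf (pd _ pg)).
  move: (partial_derivative j (partial_derivative j f) x)
    (partial_derivative j (partial_derivative j g) x) (f x) (g x)
    (partial_derivative j f x) (partial_derivative j g x) => *.
  by ring.
- by constructor => //; exact: pd.
- by constructor => //; exact: pd.
Qed.

Lemma polynomial_fun_sum m (F : 'I_m -> 'rV[R]_n -> R) :
  (forall p, polynomial_fun (F p)) -> polynomial_fun (fun x => \sum_i F i x).
Proof.
elim: m F => [|m IHm] F pF.
  by under eq_fun do rewrite big_ord0; constructor.
by under eq_fun do rewrite big_ord_recl; constructor => //; apply: IHm.
Qed.

Lemma partial_derivative_sum m (F : 'I_m -> 'rV[R]_n -> R) j :
  (forall p, polynomial_fun (F p)) ->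
  partial_derivative j (fun x => \sum_i F i x) =
  fun x => \sum_i partial_derivative j (F i) x.
Proof.
move=> pF; apply/funext => x; rewrite -derive_sum => [|i].
  rewrite /partial_derivative; congr ('D_(delta_mx 0 j) _ x).
  by apply/funext => y; rewrite fct_sumE.
exact: polynomial_fun_derivable.
Qed.

Definition sqr_norm x : R := \sum_j x 0 j ^+ 2.

Lemma polynomial_fun_sqr_norm : polynomial_fun sqr_norm.
Proof.
apply: polynomial_fun_sum => i.
by under eq_fun do rewrite expr2; do 2 constructor.
Qed.

Lemma partial_derivative_sqr_norm j :
  partial_derivative j sqr_norm = fun x => 2 * x 0 j.
Proof.
rewrite partial_derivative_sum => [|i]; last first.
  by under eq_fun do rewrite expr2; do 2 constructor.
apply/funext => x; rewrite (bigD1 j)//= big1 => [|i ij].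
  under [X in partial_derivative j X]eq_fun do rewrite expr2.
  rewrite partial_derivativeM; try by constructor.
  by rewrite partial_derivative_coord eqxx addr0 /=; ring.
under [X in partial_derivative j X]eq_fun do rewrite expr2.
rewrite partial_derivativeM; try by constructor.
by rewrite partial_derivative_coord (negPf ij) mul0r mulr0 addr0.
Qed.

Lemma laplacian_sqr_norm x : laplacian sqr_norm x = 2 * n%:R.
Proof.
rewrite /laplacian -[n in RHS]card_ord mulr_natr -sumr_const.
apply: eq_bigr => j _; rewrite partial_derivative_sqr_norm partial_derivativeZ.
  by rewrite partial_derivative_coord eqxx mulr1.
by constructor.
Qed.

End PolynomialFunctions.

(** * Harmonicity *)

(** General in [u] and [q] because it serves twice: for the function on the whole space, and for the
    two-variable function that witnesses axiality. *)
Lemma polynomial_fun_zonal (R : realType) n t k (u q : 'rV[R]_n -> R) :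
  polynomial_fun u -> polynomial_fun q ->
  polynomial_fun (fun x => zonal t (u x) (q x) k).
Proof.
move=> pu pq; elim/ltn_ind: k => -[|[|k]] IHk //.
  exact: (polynomial_fun_cst 1).
pose c1 : R := ((2 * k + 1)%:R + t) / (k%:R + t).
pose c0 : R := - k.+1%:R / (k%:R + t).
under eq_fun => x.
  rewrite zonalSS (_ : _ / _ = c1 * (u x * zonal t (u x) (q x) k.+1) +
    c0 * (q x * zonal t (u x) (q x) k)); last first.
    by rewrite mulrBl -!mulrA /c1 /c0; ring.
  over.
constructor; constructor; try exact: polynomial_fun_cst.
  by constructor => //; exact: IHk.
by constructor => //; exact: IHk.
Qed.

Section ZonalFunction.
Context {R : realType} {m : nat} (m_gt0 : (0 < m)%N).

Definition zonal_fun k (x : 'rV[R]_m.+1) : R :=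
  zonal m%:R (x 0 0) (sqr_norm x) k.

Let coef1 k : R := ((2 * k + 1)%:R + m%:R) / (k%:R + m%:R).
Let coef0 k : R := - k.+1%:R / (k%:R + m%:R).

Let denom_neq0 k : k%:R + m%:R != 0 :> R.
Proof. by rewrite -natrD pnatr_eq0 addn_eq0 [m == _]gtn_eqF// andbF. Qed.

Let zonal_funSS k : zonal_fun k.+2 = fun x =>
  coef1 k * (x 0 0 * zonal_fun k.+1 x) + coef0 k * (sqr_norm x * zonal_fun k x).
Proof.
by apply/funext => x; rewrite /zonal_fun zonalSS /coef1 /coef0; field.
Qed.

Let zonal_fun0 : zonal_fun 0 = fun=> 1.
Proof. by []. Qed.

Let zonal_fun1 : zonal_fun 1 = fun x => x 0 0.
Proof. by []. Qed.

Lemma polynomial_zonal_fun k : polynomial_fun (zonal_fun k).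
Proof.
apply: polynomial_fun_zonal; first exact: polynomial_fun_coord.
exact: polynomial_fun_sqr_norm.
Qed.

Let px0 : polynomial_fun (fun x : 'rV[R]_m.+1 => x 0 0).
Proof. by constructor. Qed.

Let pq := @polynomial_fun_sqr_norm R m.+1.
Let pZ := polynomial_zonal_fun.

Let px0Z k : polynomial_fun (fun x => x 0 0 * zonal_fun k x).
Proof. by constructor. Qed.

Let pqZ k : polynomial_fun (fun x => sqr_norm x * zonal_fun k x).
Proof. by constructor. Qed.

Let partial_zonal_funSS j k x : partial_derivative j (zonal_fun k.+2) x =
  coef1 k * ((0 == j)%:R * zonal_fun k.+1 x +
             x 0 0 * partial_derivative j (zonal_fun k.+1) x) +
  coef0 k * (2 * x 0 j * zonal_fun k x +
             sqr_norm x * partial_derivative j (zonal_fun k) x).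
Proof.
rewrite zonal_funSS partial_derivativeD; try by constructor; [constructor|].
rewrite !partial_derivativeZ// !partial_derivativeM//.
by rewrite partial_derivative_coord partial_derivative_sqr_norm.
Qed.

(** The Appell property in [x_0]. Differentiating the recurrence and applying the induction
    hypothesis in the two lower degrees leaves an identity that follows from the recurrence one
    degree lower. *)
Lemma partial_derivative_zonal_fun k x :
  partial_derivative 0 (zonal_fun k) x = k%:R * zonal_fun k.-1 x.
Proof.
elim/ltn_ind: k x => -[|[|k]] IHk x.
- by rewrite partial_derivative_cst mul0r.
- by rewrite zonal_fun1 partial_derivative_coord mul1r.
rewrite partial_zonal_funSS !IHk//= mul1r.
(* Degree 2 is separate: for [k = 0] the predecessor in [zonal_fun k.-1] is a default value,
   harmless thanks to its factor 0, and the recurrence cannot be applied to [zonal_fun 1]. *)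
case: k {IHk} => [|k].
  have := denom_neq0 0; rewrite zonal_fun1 zonal_fun0 /coef1 /coef0 add0r => m0.
  by field.
have := denom_neq0 k; have := denom_neq0 k.+1.
rewrite zonal_funSS /coef1 /coef0 /=.
rewrite -[k.+3%:R]natr1 -[k.+2%:R]natr1 -[k.+1%:R]natr1.
move: (zonal_fun k.+1 x) (zonal_fun k x) (sqr_norm x) (x 0 0).
move=> z1 z0 q x0 km1 km.
by field; rewrite km km1.
Qed.

(** Euler's identity for homogeneity of degree [k], carried through the recurrence since [x_0] has
    degree 1 and [sqr_norm] degree 2. *)
Lemma euler_zonal_fun k (x : 'rV[R]_m.+1) :
  \sum_j x 0 j * partial_derivative j (zonal_fun k) x = k%:R * zonal_fun k x.
Proof.
elim/ltn_ind: k => -[|[|k]] IHk.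
- rewrite mul0r big1// => j _.
  by rewrite zonal_fun0 partial_derivative_cst mulr0.
- rewrite zonal_fun1 mul1r (bigD1 0)//= big1 => [|j j0].
    by rewrite partial_derivative_coord mulr1 addr0.
  by rewrite partial_derivative_coord eq_sym (negPf j0) mulr0.
transitivity (
  coef1 k * ((\sum_j x 0 j * (0 == j)%:R) * zonal_fun k.+1 x +
    x 0 0 * \sum_j x 0 j * partial_derivative j (zonal_fun k.+1) x) +
  coef0 k * (2 * sqr_norm x * zonal_fun k x +
    sqr_norm x * \sum_j x 0 j * partial_derivative j (zonal_fun k) x)).
  rewrite [X in 2 * X]/sqr_norm mulr_suml !mulr_sumr mulr_suml -!big_split /=.
  rewrite !mulr_sumr -big_split; apply: eq_bigr => j _ /=.
  rewrite partial_zonal_funSS.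
  move: (partial_derivative j _ x) (partial_derivative j _ x) => *.
  by ring.
rewrite (bigD1 0)//= big1 => [|j j0]; last by rewrite eq_sym (negPf j0) mulr0.
rewrite mulr1 addr0 !IHk// zonal_funSS -[k.+2%:R]natr1 -[k.+1%:R]natr1.
by ring.
Qed.

(** Write [Z_k] for [zonal_fun k]. By induction the Laplacian of [x_0 Z_{k+1}] is [2 (k + 1) Z_k],
    by the Appell property, and that of [|x|^2 Z_k] is [(2 (m + 1) + 4 k) Z_k], by Euler's identity.
    Weighted by [coef1 k] and [coef0 k], they cancel. *)
Lemma laplacian_zonal_fun k x : laplacian (zonal_fun k) x = 0.
Proof.
elim/ltn_ind: k => -[|[|k]] IHk.
- exact: laplacian_cst.
- exact: laplacian_coord.
rewrite zonal_funSS laplacianD; try by constructor; [constructor|].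
rewrite !laplacianZ// !laplacianM// !IHk// laplacian_coord laplacian_sqr_norm.
have -> : \sum_j partial_derivative j (fun x : 'rV[R]_m.+1 => x 0 0) x *
    partial_derivative j (zonal_fun k.+1) x = k.+1%:R * zonal_fun k x.
  rewrite (bigD1 0)//= big1 => [|j j0].
    rewrite partial_derivative_coord partial_derivative_zonal_fun.
    by rewrite mul1r addr0.
  by rewrite partial_derivative_coord eq_sym (negPf j0) mul0r.
have -> : \sum_j partial_derivative j (@sqr_norm R m.+1) x *
    partial_derivative j (zonal_fun k) x = 2 * (k%:R * zonal_fun k x).
  rewrite -euler_zonal_fun mulr_sumr; apply: eq_bigr => j _.
  by rewrite partial_derivative_sqr_norm mulrA.
have := denom_neq0 k; rewrite /coef1 /coef0 -[m.+1%:R]natr1 -[k.+1%:R]natr1.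
move: (zonal_fun k.+1 x) (zonal_fun k x) (sqr_norm x) (x 0 0) => *.
by field.
Qed.

End ZonalFunction.

Lemma clifford_coord_scalar (R : realType) m (a : R) (A : {set 'I_m}) :
  clifford_coord (a%:A : clifford R m) A = (A == finset.set0)%:R * a.
Proof. by rewrite /clifford_coord !ffunE mulrC. Qed.

Lemma sqr_vector_part_norm (R : rcfType) m (x : 'rV[R]_m.+1) :
  vector_part_norm x ^+ 2 = \sum_(j < m) x 0 (lift ord0 j) ^+ 2.
Proof. by rewrite sqr_sqrtr// sumr_ge0// => j _; exact: sqr_ge0. Qed.

Theorem theorem6p4 (R : realType) (k m : nat) (hm : (0 < m)%N) :
  axially_harmonic (@P_poly R k m).
Proof.
(* Being scalar valued, the polynomial has its only possibly nonzero coordinate at the empty set. *)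
have P_coord (A : {set 'I_m}) x : clifford_coord (P_poly k x) A =
    (A == finset.set0)%:R * zonal_fun k x :> R.
  by rewrite P_polyE// clifford_coord_scalar.
split.
- move=> A; under eq_fun do rewrite P_coord; apply: polynomial_fun_analytic.
  by constructor; [exact: polynomial_fun_cst|exact: polynomial_zonal_fun].
(* The squared norm is [u ^ 2 + v ^ 2] with [v] the norm of the vector part. It is even in [v], and
   scalar values allow a zero odd component. *)
- exists (fun u v => (zonal m%:R u (u ^+ 2 + v ^+ 2) k)%:A), (fun _ _ => 0).
  split.
  + move=> A; under eq_fun do rewrite clifford_coord_scalar.
    apply: polynomial_fun_analytic.
    constructor; first exact: polynomial_fun_cst.
    apply: polynomial_fun_zonal; first exact: polynomial_fun_coord.
    by constructor; under eq_fun do rewrite expr2; do 2 constructor.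
  + move=> A; under eq_fun do rewrite [clifford_coord _ _]ffunE.
    by apply: polynomial_fun_analytic; exact: polynomial_fun_cst.
  + by move=> u v; rewrite sqrrN.
  + by move=> u v; rewrite oppr0.
  + move=> x; rewrite mulr0 addr0 P_polyE// sqr_vector_part_norm.
    by rewrite big_ord_recl.
- move=> A x; under [X in laplacian X]eq_fun do rewrite P_coord.
  rewrite laplacianZ ?laplacian_zonal_fun ?mulr0//.
  exact: polynomial_zonal_fun.
Qed.
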